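(* Let $\mathbf{A}\in\mathbb{R}^{m\times n}$ be a random matrix whose elements are drawn i.i.d. from the standard normal distribution. Then for all $i_1,i_2,i_3,i_4\in\{1,\dots,n\}$, $$\left(\mathbb{E}\left[(\mathbf{A}^{\mathsf T}\mathbf{A})^{\circ 2}\right]\right)_{i_1i_2i_3i_4}=m^2\,\delta_{i_1i_2}\delta_{i_3i_4}+m\,\delta_{i_1i_3}\delta_{i_2i_4}+m\,\delta_{i_1i_4}\delta_{i_2i_3}.$$
   Context: For a matrix $\mathbf{M}\in\mathbb{R}^{n\times n}$, $\mathbf{M}^{\circ 2}=\mathbf{M}\circ\mathbf{M}$ denotes the outer product of $\mathbf{M}$ with itself, i.e. the fourth-order tensor with entries $(\mathbf{M}\circ\mathbf{M})_{i_1i_2i_3i_4}=\mathbf{M}_{i_1i_2}\mathbf{M}_{i_3i_4}$. The expectation of a random tensor is taken entrywise. $\delta_{ij}$ is the Kronecker delta. *)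

(* Defs.v *)
From HB Require Import structures.
From mathcomp Require Import all_boot all_order all_algebra.
From mathcomp Require Import all_classical all_reals all_analysis.
Import Order.TTheory GRing.Theory Num.Theory.
Import numFieldNormedType.Exports.

Set Implicit Arguments.
Unset Strict Implicit.
Unset Printing Implicit Defensive.

Local Open Scope classical_set_scope.
Local Open Scope ring_scope.

(* The product rule is required for every subfamily J and all measurable
   events B i of the state space. *)
Definition mutually_independent d d' (T : measurableType d)
    (T' : measurableType d') (R : realType) (P : probability T R)
    (I : finType) (X : I -> {RV P >-> T'}) : Prop :=
  forall (J : {set I}) (B : I -> set T'), (forall i, measurable (B i)) ->
    P (\bigcap_(i in [set` J]) (X i @^-1` B i)) =
    (\prod_(i in J) P (X i @^-1` B i))%E.

(* Laws are compared on measurable sets only: the set function [normal_prob]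
   carries no meaning on the other sets. *)
Definition standard_normal d (T : measurableType d) (R : realType)
    (P : probability T R) (X : {RV P >-> R}) : Prop :=
  forall B : set R, measurable B -> distribution P X B = normal_prob 0 1 B.

(* A random matrix is a matrix whose entries are random variables. *)
Definition iid_standard_normal d (T : measurableType d) (R : realType)
    (P : probability T R) (m n : nat) (A : 'M[{RV P >-> R}]_(m, n)) : Prop :=
  mutually_independent (fun ij : 'I_m * 'I_n => A ij.1 ij.2) /\
  forall i j, standard_normal (A i j).

Definition sample_mx d (T : measurableType d) (R : realType)
    (P : probability T R) (m n : nat) (A : 'M[{RV P >-> R}]_(m, n)) (w : T) :
    'M[R]_(m, n) :=
  \matrix_(i, j) A i j w.

Definition tensor4 (K : Type) (n : nat) : Type :=
  'I_n -> 'I_n -> 'I_n -> 'I_n -> K.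

Definition outer_mx (R : realType) (n : nat) (M N : 'M[R]_n) : tensor4 R n :=
  fun i1 i2 i3 i4 => M i1 i2 * N i3 i4.

(* The entries are extended reals because ['E_P[_]] is. *)
Definition tensor_expectation d (T : measurableType d) (R : realType)
    (P : probability T R) (n : nat) (F : T -> tensor4 R n) :
    tensor4 (\bar R) n :=
  fun i1 i2 i3 i4 => 'E_P[fun w => F w i1 i2 i3 i4]%E.

Definition kronecker (R : realType) (n : nat) (i j : 'I_n) : R := (i == j)%:R.

(* Main.v *)
(* By bilinearity the entry is the sum over rows k, l of the expectations of
   A_{k i1} A_{k i2} A_{l i3} A_{l i4}.  Four i.i.d. standard normal factors
   have as expectation the number of pairings of equal factors (Isserlis):
   independence turns the expectation into the product over all entries of the
   moments E[Z^c], c the multiplicity of the entry, and E[Z^c] is 1, 1, 3 for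
   c = 0, 2, 4 and 0 for c odd.  The pairing within rows contributes for all
   m^2 pairs (k, l), the two other pairings only for k = l.

   Independence is only given on events, so the product formula for functions
   is obtained by replacing one coordinate at a time, first indicators by
   nonnegative functions and then those by integrable ones. *)
Require Import Defs.
From mathcomp Require Import all_boot all_order all_algebra.
From mathcomp Require Import all_classical all_reals all_analysis.
From mathcomp Require Import measurable_realfun zify ring lra.
Import Order.TTheory GRing.Theory Num.Theory.
Import numFieldNormedType.Exports.

Set Implicit Arguments.
Unset Strict Implicit.
Unset Printing Implicit Defensive.

Local Open Scope classical_set_scope.
Local Open Scope ring_scope.

(** * Extension of integral identities from indicators to nonnegative functions *)

Section transport.
Import HBNNSimple.
Local Open Scope ereal_scope.

(** Both sides are additive in [f] and continuous along increasing sequences, so the indicator case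
    passes to simple functions and then to limits. It serves twice: with [g] the product of the
    remaining independent factors and [nu] the law of one variable, and with [g] a density and [X]
    the identity. *)
Lemma ge0_integral_density_comp d1 d2 (T1 : measurableType d1)
    (T2 : measurableType d2) (R : realType)
    (mu : {measure set T1 -> \bar R}) (nu : {measure set T2 -> \bar R})
    (X : T1 -> T2) (g : T1 -> R) (c : R) :
    measurable_fun [set: T1] X -> measurable_fun [set: T1] g ->
    (forall x, 0 <= g x)%R -> (0 <= c)%R ->
    (forall B, measurable B ->
      \int[mu]_x (g x * \1_B (X x))%:E = c%:E * nu B) ->
  forall f : T2 -> R, measurable_fun [set: T2] f -> (forall y, 0 <= f y)%R ->
  \int[mu]_x (g x * f (X x))%:E = c%:E * \int[nu]_y (f y)%:E.
Proof.
move=> mX mg g0 c0 gB f mf f0.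
have mEf : measurable_fun [set: T2] (fun y => (f y)%:E).
  exact/measurable_EFinP.
pose h := nnsfun_approx measurableT mEf.
have hf y : EFin \o h^~ y @ \oo --> (f y)%:E.
  apply: (@cvg_nnsfun_approx _ _ _ _ measurableT _ mEf) => // ? _.
  by rewrite lee_fin.
have hnd : nondecreasing_seq (h : (T2 -> R)^nat) by exact: nd_nnsfun_approx.
have mhX n : measurable_fun [set: T1] (h n \o X) by exact: measurableT_comp.
have step n : \int[mu]_x (g x * h n (X x))%:E = c%:E * \int[nu]_y (h n y)%:E.
  have r0 r : r \in range (h n) -> (0 <= r)%R by rewrite inE => -[y _ <-].
  have mset r : measurable (h n @^-1` [set r]) by exact: measurable_funPTI.
  (* A simple function is the finite sum of its values times the indicators of its level sets, and
     [gB] applies to each level set. *)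
  transitivity
      (\sum_(r \in range (h n)) (r%:E * (c%:E * nu (h n @^-1` [set r])))).
    under eq_integral do rewrite fimfunE mulr_fsumr -fsumEFin//.
    rewrite ge0_integral_fsum//; last 2 first.
    - move=> r; apply/measurable_EFinP/measurable_funM => //.
      apply: measurable_funM => //.
      by apply: measurableT_comp mX; exact: measurable_indic.
    - move=> r x _; rewrite EFinM mule_ge0 ?lee_fin//.
      exact: (nnfun_muleindic_ge0 (h n) r (X x)).
    apply: eq_fsbigr => r rhn.
    rewrite -gB// -ge0_integralZl//; last 3 first.
    - apply/measurable_EFinP/measurable_funM => //.
      by apply: measurableT_comp mX; exact: measurable_indic.
    - by move=> x _; rewrite lee_fin mulr_ge0.
    - by rewrite lee_fin r0.
    by apply: eq_integral => x _; rewrite -EFinM mulrCA.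
  have -> : \int[nu]_y (h n y)%:E = sintegral nu (h n).
    by rewrite -integralT_nnsfun.
  rewrite sintegralE.
  rewrite ge0_mule_fsumr//.
    by apply: eq_fsbigr => r _; rewrite muleCA.
  by move=> r; exact: nnsfun_mulemu_ge0.
(* [l1] and [l2] are the monotone limits of the two integrals in [step]; uniqueness of limits
   concludes. *)
have l1 : \int[mu]_x (g x * h n (X x))%:E @[n --> \oo] -->
    \int[mu]_x (g x * f (X x))%:E.
  rewrite [X in _ --> X](_ : _ =
      \int[mu]_x limn (fun n => (g x * h n (X x))%:E)); last first.
    apply: eq_integral => x _; apply/esym/cvg_lim => //.
    rewrite EFinM; under eq_fun do rewrite EFinM.
    by apply: cvgeZl => //; exact: hf.
  apply: cvg_monotone_convergence => //.
  - move=> n; apply/measurable_EFinP; apply: measurable_funM => //.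
    exact: mhX.
  - by move=> n x _; rewrite lee_fin mulr_ge0.
  - by move=> x _ m n mn; rewrite lee_fin ler_wpM2l//; exact/lefP/hnd.
have l2 : \int[nu]_y (h n y)%:E @[n --> \oo] --> \int[nu]_y (f y)%:E.
  rewrite [X in _ --> X](_ : _ =
      \int[nu]_y limn (fun n => (h n y)%:E)); last first.
    by apply: eq_integral => y _; apply/esym/cvg_lim => //; exact: hf.
  apply: cvg_monotone_convergence => //.
  - by move=> n; exact/measurable_EFinP.
  - by move=> n x _; rewrite lee_fin.
  - by move=> x _ m n mn; rewrite lee_fin; exact/lefP/hnd.
apply: (cvg_unique _ l1) => //.
by rewrite (funext step); apply: cvgeZl.
Qed.

End transport.
(** Induction on a list [s] containing every coordinate at which only [C] is known: each step trades
    one of them for functions satisfying [D], until [base] applies. *)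
Lemma coordinatewise_ind (I : finType) (A : Type) (C D : I -> A -> Prop)
    (Q : (I -> A) -> Prop) :
    (forall i a, D i a -> C i a) ->
    (forall F, (forall i, D i (F i)) -> Q F) ->
    (forall F i, (forall j, C j (F j)) ->
      (forall a, D i a -> Q [eta F with i |-> a]) -> Q F) ->
  forall F, (forall i, C i (F i)) -> Q F.
Proof.
move=> DC base step F CF.
suff gen (s : seq I) : forall G, (forall i, C i (G i)) ->
    (forall i, i \notin s -> D i (G i)) -> Q G.
  by apply: (gen (enum I)) => // i; rewrite mem_enum.
elim: s => [|i s IHs] G CG DG; first by apply: base => i; exact: DG.
apply: (step G i) => // a Da; apply: IHs => j /=; case: eqVneq => [->|ji] //.
- exact: DC.
- by move=> js; apply: DG; rewrite inE negb_or ji.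
Qed.

(** * The product formula for expectations of independent variables *)

Section independent_product.
Context d d' (T : measurableType d) (T' : measurableType d') (R : realType).
Context (P : probability T R) (I : finType) (X : I -> {RV P >-> T'}).
Hypothesis indepX : mutually_independent X.
Implicit Types (F : I -> T' -> R) (f : T' -> R).

Let prodE F i f w : \prod_j [eta F with i |-> f] j (X j w) =
  f (X i w) * \prod_(j | j != i) F j (X j w).
Proof.
rewrite (bigD1 i)//= eqxx; congr (_ * _).
by apply: eq_bigr => j /negbTE ->.
Qed.

Let Rprod F := \prod_i \int[P]_w F i (X i w).

Let product_rule F := (\int[P]_w (\prod_i F i (X i w))%:E = (Rprod F)%:E)%E.

Let RprodE F i f : Rprod [eta F with i |-> f] =
  (\int[P]_w f (X i w)) * \prod_(j | j != i) \int[P]_w F j (X j w).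
Proof.
rewrite /Rprod (bigD1 i)//= eqxx; congr (_ * _).
by apply: eq_bigr => j /negbTE ->.
Qed.

Let indicator f := exists B, measurable B /\ f = \1_B.

(** Integrability of the composite does not make [f] itself measurable, which the passage to the law
    of [X i] requires. *)
Let integrable_at i f := measurable_fun [set: T'] f /\
  P.-integrable [set: T] (fun w => (f (X i w))%:E).

Let ge0_integrable_at i f := (forall y, 0 <= f y) /\ integrable_at i f.

Let measurable_comp i f : measurable_fun [set: T'] f ->
  measurable_fun [set: T] (fun w => f (X i w)).
Proof. by move=> mf; apply: measurableT_comp. Qed.

Let indicator_ge0_integrable i f : indicator f -> ge0_integrable_at i f.
Proof.
move=> [B [mB ->]]; split; first by move=> y; rewrite indicE ler0n.
split; first exact: measurable_indic.
rewrite (_ : (fun w => _) = EFin \o \1_(X i @^-1` B)); last exact/funext.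
by apply: integrable_indic; exact: measurable_funPTI.
Qed.

Let RintegralindE i B : measurable B ->
  \int[P]_w (\1_B (X i w)) = fine (P (X i @^-1` B)).
Proof.
move=> mB; rewrite /Rintegral; congr fine.
rewrite -[in RHS](setIT (X i @^-1` B)) -integral_indic//.
exact: measurable_funPTI.
Qed.

(** A product of indicators evaluated at the [X i] is the indicator of the intersection of the
    preimages, so this is independence for the full index set. *)
Let product_rule_indicator F : (forall i, indicator (F i)) -> product_rule F.
Proof.
move=> /choice[B FB].
have mB i : measurable (B i) by case: (FB i).
have mXB i : measurable (X i @^-1` B i) by exact: measurable_funPTI.
have PB : P (\bigcap_(i in [set` [set: I]%SET]) (X i @^-1` B i)) =
    (\prod_i fine (P (X i @^-1` B i)))%:E.
  rewrite indepX// -prodEFin; apply: eq_big => [i|i _]; first by rewrite inE.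
  by rewrite fineK ?fin_num_measure.
transitivity (P (\bigcap_(i in [set` [set: I]%SET]) (X i @^-1` B i))).
  rewrite -[in RHS](setIT (\bigcap_(i in _) _)) -integral_indic//; last first.
    by apply: fin_bigcap_measurable => //; exact: finite_finset.
  apply: eq_integral => w _; congr EFin.
  have [Bw|/existsNP[i Biw]] := pselect (forall i, B i (X i w)).
    rewrite big1 => [|i _]; first by rewrite indicE mem_set// => i _; exact: Bw.
    by case: (FB i) => _ ->; rewrite indicE mem_set.
  rewrite (bigD1 i)//=; case: (FB i) => _ ->.
  rewrite indicE memNset// mul0r indicE memNset// => /(_ i).
  by apply: contra_not Biw; apply; rewrite /= inE.
rewrite PB /Rprod; congr EFin; apply: eq_bigr => i _.
by case: (FB i) => _ ->; rewrite RintegralindE.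
Qed.

Let product_rule_ge0 F :
  (forall i, ge0_integrable_at i (F i)) -> product_rule F.
Proof.
move: F.
apply: (coordinatewise_ind _ product_rule_indicator) => [i f|F i CF QF].
  exact: indicator_ge0_integrable.
have [Fi0 [mFi iFi]] := CF i.
(* [g] collects the other factors and [c] their expectations. The rule with an indicator at
   coordinate [i] says that integrating [g] over the preimage of [B] under [X i] gives [c] times its
   probability; this extends from indicators to [F i]. *)
pose g w := \prod_(j | j != i) F j (X j w).
pose c := \prod_(j | j != i) \int[P]_w F j (X j w).
have FE w : \prod_j F j (X j w) = g w * F i (X i w).
  by rewrite (bigD1 i)//= mulrC.
rewrite /product_rule; under eq_integral do rewrite FE.
rewrite (@ge0_integral_density_comp _ _ _ _ _ P
  (distribution P (X i)) (X i) g c)//.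
- rewrite ge0_integral_distribution//; last exact/measurable_EFinP.
  rewrite /Rprod (bigD1 i)//= -/c EFinM muleC /Rintegral fineK//.
  exact: integrable_fin_num.
- rewrite /g; under eq_fun do rewrite -big_filter.
  apply: measurable_prod => j _; apply: measurable_comp.
  by case: (CF j) => _ [].
- by move=> w; apply: prodr_ge0 => j _; case: (CF j).
- by apply: prodr_ge0 => j _; apply: Rintegral_ge0 => // w _; case: (CF j).
- move=> B mB; have := QF (\1_B) (ex_intro _ B (conj mB erefl)).
  rewrite /product_rule RprodE => QB.
  transitivity (\int[P]_w (\prod_j [eta F with i |-> \1_B] j (X j w))%:E)%E.
    by apply: eq_integral => w _; rewrite prodE mulrC.
  rewrite QB RintegralindE// EFinM muleC fineK// fin_num_measure//.
  exact: measurable_funPTI.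
Qed.

(** Applied to the absolute values, the nonnegative rule makes the integral of the absolute product
    a real number, hence finite. *)
Lemma integrable_prod_independent F : (forall i, integrable_at i (F i)) ->
  P.-integrable [set: T] (fun w => (\prod_i F i (X i w))%:E).
Proof.
move=> iF; apply/integrableP; split.
  apply/measurable_EFinP; apply: measurable_prod => i _.
  by apply: measurable_comp; case: (iF i).
under eq_integral do rewrite /= normr_prod.
rewrite (@product_rule_ge0 (fun i y => `|F i y|)) ?ltry// => i.
have [mF intF] := iF i; split => //; split; first exact: measurableT_comp.
exact: (integrable_norm intF).
Qed.

(** Both sides are linear in each coordinate, so [F i] may be split into its positive and negative
    parts. Integrability of the two resulting products justifies subtracting their integrals. *)
Lemma integral_prod_independent F : (forall i, integrable_at i (F i)) ->
  (\int[P]_w (\prod_i F i (X i w))%:E = (\prod_i \int[P]_w F i (X i w))%:E)%E.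
Proof.
move: F; apply: (coordinatewise_ind _ product_rule_ge0) => [i f []//|F i CF QF].
have [mFi iFi] := CF i.
have ip : ge0_integrable_at i (F i)^\+.
  split; first exact: funrpos_ge0.
  split; first exact: measurable_funrpos.
  exact: (integrable_funrpos _ iFi).
have im : ge0_integrable_at i (F i)^\-.
  split; first exact: funrneg_ge0.
  split; first exact: measurable_funrneg.
  exact: (integrable_funrneg _ iFi).
have intp f : ge0_integrable_at i f ->
    P.-integrable [set: T]
      (fun w => (\prod_j [eta F with i |-> f] j (X j w))%:E).
  move=> If; apply: integrable_prod_independent => j /=.
  by case: eqVneq => [->|_]; [case: If|exact: CF].
transitivity (\int[P]_w ((\prod_j [eta F with i |-> (F i)^\+] j (X j w))%:E
   - (\prod_j [eta F with i |-> (F i)^\-] j (X j w))%:E))%E.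
  apply: eq_integral => w _; rewrite -EFinB !prodE -mulrBl (bigD1 i)//=.
  by congr (_ * _)%:E; rewrite -[in LHS](funrposBneg (F i)).
rewrite integralB_EFin//; [|exact: intp..].
rewrite QF// QF// -EFinB !RprodE -mulrBl; congr EFin.
rewrite [RHS](bigD1 i)//=; congr (_ * _).
rewrite -RintegralB//; [|by case: ip => _ []|by case: im => _ []].
by apply: eq_Rintegral => w _; rewrite -[in RHS](funrposBneg (F i)).
Qed.

End independent_product.

(** * Moments of the standard normal density *)

Section gaussian_moments.
Context {R : realType}.
Local Notation mu := lebesgue_measure.
Local Notation phi := (@normal_pdf R 0 1).

Lemma normal_pdf01E x : phi x = normal_peak 1 * expR (- (x ^+ 2 / 2)).
Proof.
by rewrite normal_pdfE ?oner_neq0// /normal_fun subr0 expr1n mulNr.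
Qed.

Lemma normal_pdf01N x : phi (- x) = phi x.
Proof. by rewrite !normal_pdf01E sqrrN. Qed.

Lemma is_derive_normal_pdf01 (x : R) : is_derive x 1 phi (- (x * phi x)).
Proof.
rewrite (funext normal_pdf01E).
apply: is_derive_eq.
rewrite /GRing.scale /=.
by field.
Qed.

Lemma continuous_normal_pdf01 : continuous phi.
Proof. by apply: continuous_normal_pdf; exact: oner_neq0. Qed.

Let h k (x : R) := x ^+ k * phi x.

Let continuous_h k : continuous (h k).
Proof.
move=> x; apply: cvgM; first exact: exprn_continuous.
exact: continuous_normal_pdf01.
Qed.

(** The factors are [x ^+ k.+1] and [- phi], the latter an antiderivative of [x * phi x]. The
    boundary term at 0 vanishes because the exponent [k.+1] is positive. *)
Lemma integral_exprM_normal_pdf01_by_parts k (a : R) : 0 < a ->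
  (\int[mu]_(x in `[0%R, a]) (h k.+2 x)%:E =
   - (h k.+1 a)%:E + k.+1%:R%:E * \int[mu]_(x in `[0%R, a]) (h k x)%:E)%E.
Proof.
move=> a0.
have int_h j : mu.-integrable `[0, a] (fun x => (h j x)%:E).
  apply: continuous_compact_integrable; first exact: segment_compact.
  exact/continuous_subspaceT/continuous_h.
have := @integration_by_parts R (fun x => x ^+ k.+1) (fun x => - phi x)
  (fun x => k.+1%:R * x ^+ k) (fun x => x * phi x) 0 a a0.
under eq_integral => x _ do rewrite mulrA -exprSr -/(h k.+2 x).
move=> ->.
- rewrite expr0n/= mul0r subr0 mulrN EFinN; congr (_ + _)%E.
  rewrite (_ : (fun x => _) = fun x => (- k.+1%:R)%:E * (h k x)%:E)%E;
    last first.
    by apply/funext => x; rewrite -EFinM mulrN mulNr mulrA.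
  by rewrite integralZl// EFinN mulNe oppeK.
- apply: continuous_subspaceT => x; apply: cvgM; first exact: cvg_cst.
  exact: exprn_continuous.
- split=> [x _||]; first exact: exprn_derivable.
    by apply: cvg_at_right_filter; exact: exprn_continuous.
  by apply: cvg_at_left_filter; exact: exprn_continuous.
- by move=> x _; rewrite derive1E exp_derive /GRing.scale/= mulr1.
- apply: continuous_subspaceT => x; apply: cvgM => //.
  exact: continuous_normal_pdf01.
- split=> [x _||].
  + by have dphi := is_derive_normal_pdf01 x; exact: derivableN.
  + apply: cvg_at_right_filter; apply: cvgN; exact: continuous_normal_pdf01.
  + apply: cvg_at_left_filter; apply: cvgN; exact: continuous_normal_pdf01.
- move=> x _; have dphi := is_derive_normal_pdf01 x.
  rewrite derive1E deriveN//.
  by rewrite derive_val opprK.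
Qed.

(** The term of order [k.+2] of the exponential series at [n%:R ^+ 2 / 2] grows like the power 2k+4
    of n, which beats the power k+1 with room to spare: a bound [C / n%:R] suffices. *)
Lemma cvg_exprM_normal_pdf01 k : h k.+1 n%:R @[n --> \oo] --> (0:R).
Proof.
(* The factorial and the power of 2 undo the coefficient of that term. *)
pose C : R := normal_peak 1 * ((k.+2)`!%:R * 2 ^+ k.+2).
have hC (n : nat) : (0 < n)%N -> h k.+1 n%:R <= C / n%:R.
  move=> n0; have n0' : 0 < n%:R :> R by rewrite ltr0n.
  rewrite /h normal_pdf01E expRN.
  have e := @expR_ge1Dxn R (n%:R ^+ 2 / 2) k.+1.
  have {}e : (n%:R ^+ 2 / 2) ^+ k.+2 / k.+2`!%:R <= expR (n%:R ^+ 2 / 2) :> R.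
    by apply: le_trans (e _); [rewrite lerDr|rewrite divr_ge0 ?sqr_ge0].
  rewrite mulrCA /C -[leRHS]mulrA ler_wpM2l ?normal_peak_ge0//.
  rewrite ler_pdivrMr ?expR_gt0//.
  apply: le_trans (ler_wpM2l _ e).
    (* After cancellation the bound exceeds the left side by the factor [n%:R ^+ k.+2], at least
       1. *)
    have -> : (k.+2)`!%:R * 2 ^+ k.+2 / n%:R *
        ((n%:R ^+ 2 / 2) ^+ k.+2 / (k.+2)`!%:R) =
        n%:R ^+ k.+1 * n%:R ^+ k.+2 :> R.
      have e2 : (2 * k.+2 = (k.+1 + k.+2).+1)%N by rewrite mul2n -addnn addSn.
      rewrite expr_div_n -exprM e2.
      have f0 : (k.+2)`!%:R != 0 :> R by rewrite pnatr_eq0 -lt0n fact_gt0.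
      have p0 : 2 ^+ k.+2 != 0 :> R by rewrite expf_neq0// pnatr_eq0.
      have n1 : n%:R != 0 :> R by rewrite gt_eqF.
      rewrite [_ ^+ (_ + _).+1]exprS exprD.
      move: (_ ^+ k.+1) (n%:R ^+ k.+2) (2 ^+ k.+2) p0 => u v p p0.
      by field; rewrite p0 f0 n1.
    by rewrite ler_peMr ?exprn_ge0// exprn_ege1// ler1n.
  by rewrite divr_ge0// mulr_ge0// exprn_ge0.
apply/cvgrPdist_le => e e0; near=> n.
rewrite sub0r normrN ger0_norm ?mulr_ge0 ?exprn_ge0 ?normal_pdf_ge0//.
apply: le_trans (hC _ _) _.
  by near: n; exists 1%N.
rewrite ler_pdivrMr; last by near: n; exists 1%N => // n /=; rewrite ltr0n.
rewrite -ler_pdivrMl//.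
by near: n; exact: nbhs_infty_ger.
Unshelve. all: end_near. Qed.


Let h_even_ge0 j x : 0 <= h j.*2 x.
Proof. by rewrite mulr_ge0 ?normal_pdf_ge0// exprn_even_ge0// odd_double. Qed.

Let measurable_h k : measurable_fun setT (h k).
Proof. by apply: continuous_measurable_fun; exact: continuous_h. Qed.

(** Integration by parts on [0, n] with k = 2j, then n to infinity, where the boundary term
    disappears. Even exponents keep the integrands nonnegative, so the integrals over [0, n]
    converge to those over the half-line. *)
Lemma half_integral_exprM_normal_pdf01 j :
  (\int[mu]_(x in `[0%R, +oo[) (h j.+1.*2 x)%:E =
   j.*2.+1%:R%:E * \int[mu]_(x in `[0%R, +oo[) (h j.*2 x)%:E)%E.
Proof.
have cv i := @ge0_cvgn_integral R mu _ (h_even_ge0 i) (@measurable_h i.*2).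
apply: (cvg_unique _ (cv j.+1)) => //.
have l : (- (h j.*2.+1 n%:R)%:E +
    j.*2.+1%:R%:E * \int[mu]_(x in `[0%R, n%:R]) (h j.*2 x)%:E)%E
      @[n --> \oo] -->
    (0 + j.*2.+1%:R%:E * \int[mu]_(x in `[0%R, +oo[) (h j.*2 x)%:E)%E.
  apply: cvgeD => //.
  - rewrite -[0%E]oppe0; apply: cvgeN; apply: cvg_EFin; first exact: nearW.
    exact: cvg_exprM_normal_pdf01.
  - by apply: cvgeZl.
rewrite add0e in l; apply: cvg_trans l; apply: near_eq_cvg.
near=> n; rewrite doubleS integral_exprM_normal_pdf01_by_parts// ltr0n.
by near: n; exists 1%N.
Unshelve. all: end_near. Qed.

(** The value is the double factorial (2j-1)!!. By evenness the half-line recursion holds on the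
    whole line, starting from total mass 1. *)
Lemma integral_even_exprM_normal_pdf01 j :
  (\int[mu]_x (h j.*2 x)%:E = (\prod_(i < j) i.*2.+1%:R)%:E)%E.
Proof.
have hE i : (\int[mu]_x (h i.*2 x)%:E =
    2%:E * \int[mu]_(x in `[0%R, +oo[) (h i.*2 x)%:E)%E.
  rewrite ge0_symfun_integralT ?set_itvcy// => x /=.
  by rewrite /h normal_pdf01N exprNn -signr_odd odd_double mul1r.
elim: j => [|j IHj].
  rewrite big_ord0 -(integral_normal_pdf 0 1).
  by apply: eq_integral => x _; rewrite /h expr0 mul1r.
rewrite hE half_integral_exprM_normal_pdf01 muleCA -hE IHj.
by rewrite big_ord_recr/= mulrC EFinM.
Qed.

(** Splitting the line at 0 and reflecting the negative half gives two half-line integrals, which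
    the change of sign merely exchanges. *)
Lemma ge0_integralT_oppr (f : R -> R) : (forall x, 0 <= f x) -> continuous f ->
  (\int[mu]_x (f (- x))%:E = \int[mu]_x (f x)%:E)%E.
Proof.
have split_int (g : R -> R) : (forall x, 0 <= g x) -> continuous g ->
    (\int[mu]_x (g x)%:E = \int[mu]_(x in `[0%R, +oo[) (g x)%:E +
      \int[mu]_(x in `[0%R, +oo[) (g (- x))%:E)%E.
  move=> g0 cg.
  have mg : measurable_fun [set: R] g by exact: continuous_measurable_fun.
  rewrite -(setUv `[0%R, +oo[%classic) ge0_integral_setU//=; last 4 first.
  - exact: measurableC.
  - by apply/measurable_EFinP; rewrite setUv.
  - by move=> x _; rewrite lee_fin.
  - exact/disj_setPCl.
  congr (_ + _)%E; rewrite setCitvr integral_itv_bndo_bndc; last first.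
    exact/measurable_EFinP/measurable_funTS.
  (* The endpoint 0 is written as [- 0] to fit the substitution rule. *)
  rewrite -{1}oppr0 ge0_integration_by_substitutionNy//.
  exact: continuous_subspaceT.
move=> f0 cf; rewrite split_int//; last first.
  by move=> x; apply: continuous_comp; [exact: opp_continuous|exact: cf].
rewrite [RHS]split_int// addeC; congr (_ + _)%E.
by under eq_integral do rewrite opprK.
Qed.

(** Reflection exchanges the positive and negative parts of an odd power and preserves [phi]. *)
Lemma integral_funrneg_odd_exprM_normal_pdf01 k : odd k ->
  (\int[mu]_x (phi x * (fun x : R => x ^+ k)^\- x)%:E =
   \int[mu]_x (phi x * (fun x : R => x ^+ k)^\+ x)%:E)%E.
Proof.
move=> oddk; rewrite -[RHS]ge0_integralT_oppr.
- apply: eq_integral => x _; congr (_ * _)%:E.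
    by rewrite normal_pdf01N.
  by rewrite /funrpos /funrneg exprNn -signr_odd oddk expr1 mulN1r.
- by move=> x; rewrite mulr_ge0 ?normal_pdf_ge0// funrpos_ge0.
- move=> x; apply: cvgM; first exact: continuous_normal_pdf01.
  apply: continuous_max; [exact: exprn_continuous|exact: cvg_cst].
Qed.

End gaussian_moments.

(** * Moments of a standard normal variable *)

Section standard_normal_moments.
Context d (T : measurableType d) (R : realType) (P : probability T R).
Context (X : {RV P >-> R}) (normalX : standard_normal X).
Local Notation mu := lebesgue_measure.
Local Notation phi := (@normal_pdf R 0 1).

(** Normality says that the law of [X] has density [phi] on measurable sets, which is the indicator
    case on the real line with the identity map and constant 1. *)
Lemma ge0_integral_standard_normal (f : R -> R) :
  measurable_fun [set: R] f -> (forall x, 0 <= f x) ->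
  (\int[P]_w (f (X w))%:E = \int[mu]_x (phi x * f x)%:E)%E.
Proof.
move=> mf f0.
rewrite (@ge0_integral_density_comp _ _ _ _ _ mu (distribution P X) id phi 1)//.
- rewrite mul1e ge0_integral_distribution//; first exact/measurable_EFinP.
- exact: measurable_normal_pdf.
- exact: normal_pdf_ge0.
- move=> B mB; rewrite mul1e -[RHS]/(distribution P X B) normalX//.
  rewrite /normal_prob [RHS]integral_mkcond.
  apply: eq_integral => x _; rewrite patchE indicE.
  by case: ifP; rewrite ?mulr1 ?mulr0.
Qed.

Lemma integral_even_expr_standard_normal j :
  (\int[P]_w (X w ^+ j.*2)%:E = (\prod_(i < j) i.*2.+1%:R)%:E)%E.
Proof.
rewrite (ge0_integral_standard_normal (f := fun x => x ^+ j.*2)).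
- rewrite -integral_even_exprM_normal_pdf01.
  by apply: eq_integral => x _; rewrite mulrC.
- exact: measurable_funX.
- by move=> x; rewrite exprn_even_ge0// odd_double.
Qed.

(** Since |t| <= 1 + t^2 for t = [X w ^+ k], every power is dominated by even ones, whose integrals
    are finite. *)
Lemma integrable_expr_standard_normal k :
  P.-integrable [set: T] (fun w => (X w ^+ k)%:E).
Proof.
have mXk j : measurable_fun [set: T] (fun w => X w ^+ j).
  exact: measurable_funX.
have int2 j : P.-integrable [set: T] (fun w => (X w ^+ j.*2)%:E).
  apply/integrableP; split; first exact/measurable_EFinP.
  under eq_integral do rewrite /= ger0_norm ?exprn_even_ge0 ?odd_double//.
  by rewrite integral_even_expr_standard_normal ltry.
(* The constant 1 appears as [X w ^+ 0.*2], so that [int2] covers both summands. *)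
apply: (@le_integrable _ _ _ P _ measurableT _
  (fun w => (X w ^+ 0.*2)%:E + (X w ^+ k.*2)%:E)%E).
- exact/measurable_EFinP.
- move=> w _; rewrite -EFinD !abse_EFin lee_fin.
  have X2 : 0 <= X w ^+ k.*2 by rewrite exprn_even_ge0// odd_double.
  rewrite expr0 [leRHS]ger0_norm; last by rewrite addr_ge0.
  rewrite -muln2 exprM -(real_normK (num_real (X w ^+ k))); set t := `|_|.
  have t0 : 0 <= t by exact: normr_ge0.
  nra.
- by apply: integrableD.
Qed.

Lemma Rintegral_even_expr_standard_normal j :
  \int[P]_w (X w ^+ j.*2) = \prod_(i < j) i.*2.+1%:R.
Proof. by rewrite /Rintegral integral_even_expr_standard_normal. Qed.

Lemma Rintegral_odd_expr_standard_normal k : odd k -> \int[P]_w (X w ^+ k) = 0.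
Proof.
move=> oddk; pose f (x : R) := x ^+ k.
have mf : measurable_fun [set: R] f by exact: measurable_funX.
have iX : P.-integrable [set: T] (EFin \o (f \o X)).
  exact: integrable_expr_standard_normal.
rewrite (_ : (fun w => _) = fun w => f^\+ (X w) - f^\- (X w)); last first.
  by apply/funext => w; rewrite -[LHS]/(f (X w)) -[in LHS](funrposBneg f).
rewrite RintegralB//; last 2 first.
- exact: (integrable_funrpos _ iX).
- exact: (integrable_funrneg _ iX).
rewrite /Rintegral (ge0_integral_standard_normal (measurable_funrneg mf))//.
rewrite (ge0_integral_standard_normal (measurable_funrpos mf))//.
by rewrite integral_funrneg_odd_exprM_normal_pdf01// subrr.
Qed.

End standard_normal_moments.

(** * Counting the pairings of four indices *)

Section pairings.
Context (I : finType) (R : comPzRingType) (M : nat -> R).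
Hypotheses (M0 : M 0 = 1) (M2 : M 2 = 1) (M4 : M 4 = 3%:R).
Hypothesis M_odd : forall k, odd k -> M k = 0.
Implicit Types p q r s i : I.

Let mult p q r s i := ((p == i) + (q == i) + (r == i) + (s == i))%N.

Let prod_odd p q r s i : odd (mult p q r s i) -> \prod_j M (mult p q r s j) = 0.
Proof. by move=> odd_i; rewrite (bigD1 i)//= M_odd// mul0r. Qed.

Let prod_two_pairs p q r s a b : a != b ->
  (forall i, mult p q r s i = (a == i).*2 + (b == i).*2)%N ->
  \prod_j M (mult p q r s j) = 1.
Proof.
move=> ab multE; rewrite (bigD1 a)//= (bigD1 b) 1?eq_sym//= !multE !eqxx.
rewrite (negbTE ab) eq_sym (negbTE ab) M2 !mul1r big1// => i /andP[ia ib].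
by rewrite multE !(eq_sym _ i) (negbTE ia) (negbTE ib).
Qed.

(** The multiplicities add up to 4: either all four indices agree, or they form two distinct pairs,
    or some index has odd multiplicity. Both sides are then 3, 1 and 0 respectively. *)
Lemma prod_moments_pairings p q r s :
  \prod_i M ((p == i) + (q == i) + (r == i) + (s == i))%N =
  (p == q)%:R * (r == s)%:R + (p == r)%:R * (q == s)%:R
  + (p == s)%:R * (q == r)%:R.
Proof.
have [<-{q}|npq] := eqVneq p q.
  have [<-{s}|nrs] := eqVneq r s.
    have [<-{r}|npr] := eqVneq p r.
      rewrite (bigD1 p)//= eqxx M4 big1 ?mulr1 => [|i ip].
        by rewrite -!natrD.
      by rewrite eq_sym (negbTE ip).
    rewrite (prod_two_pairs npr) => [|i].
      by rewrite !(mulr0, mulr1) !addr0.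
    by rewrite /mult -!addnn addnA.
  (* With p = q and r different from s, the index [r] occurs once or three times. *)
  rewrite (@prod_odd _ _ _ _ r); last first.
    rewrite /mult eqxx (eq_sym s) (negbTE nrs) addn0 addn1 /=.
    by rewrite addnn odd_double.
  have [pr|_] := eqVneq p r; last by rewrite !(mulr0, mul0r) !addr0.
  by rewrite -pr in nrs; rewrite (negbTE nrs) !(mulr0, mul0r) !addr0.
rewrite mul0r add0r.
have nqp : q != p by rewrite eq_sym.
have [<-{r}|npr] := eqVneq p r.
  rewrite mul1r (negbTE nqp) mulr0 addr0.
  have [<-{s}|nqs] := eqVneq q s.
    apply: (prod_two_pairs npq) => i.
    by rewrite /mult -!addnn; lia.
  apply: (@prod_odd _ _ _ _ q).
  by rewrite /mult eqxx (negbTE npq) (eq_sym s) (negbTE nqs).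
rewrite mul0r add0r.
have [<-{s}|nps] := eqVneq p s.
  rewrite mul1r; have [<-{r npr}|nqr] := eqVneq q r.
    apply: (prod_two_pairs npq) => i.
    by rewrite /mult -!addnn; lia.
  apply: (@prod_odd _ _ _ _ q).
  by rewrite /mult eqxx (negbTE npq) (eq_sym r) (negbTE nqr).
rewrite mul0r; apply: (@prod_odd _ _ _ _ p).
by rewrite /mult eqxx (negbTE nqp) !(eq_sym _ p) (negbTE npr) (negbTE nps).
Qed.

End pairings.

Lemma prod_expr_eq (I : finType) (R : comPzRingType) (x : I -> R) (p : I) :
  \prod_i x i ^+ (p == i) = x p.
Proof.
rewrite (bigD1 p)//= eqxx big1 ?mulr1// => i ip.
by rewrite eq_sym (negbTE ip).
Qed.

(** * Isserlis formula for four factors *)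

Section iid_standard_normal_product.
Context d (T : measurableType d) (R : realType) (P : probability T R).
Context (I : finType) (X : I -> {RV P >-> R}).
Hypotheses (indepX : mutually_independent X).
Hypothesis (normalX : forall i, standard_normal (X i)).

(** Grouping equal factors into powers makes the product range over distinct, hence independent,
    variables. *)
Let prodE p q r s w : X p w * X q w * X r w * X s w =
  \prod_i X i w ^+ ((p == i) + (q == i) + (r == i) + (s == i)).
Proof.
under eq_bigr do rewrite !exprD.
by rewrite !big_split/= !(prod_expr_eq (fun i => X i w)).
Qed.

Let integrable_at k i : measurable_fun [set: R] (fun x : R => x ^+ k) /\
  P.-integrable [set: T] (fun w => (X i w ^+ k)%:E).
Proof.
by split; [exact: measurable_funX|exact: integrable_expr_standard_normal].
Qed.

Lemma integrable_product4_standard_normal p q r s :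
  P.-integrable [set: T] (fun w => (X p w * X q w * X r w * X s w)%:E).
Proof.
rewrite (funext (fun w => congr1 EFin (prodE p q r s w))).
exact: (integrable_prod_independent indepX (fun i => integrable_at _ i)).
Qed.

Lemma isserlis4 p q r s :
  (\int[P]_w (X p w * X q w * X r w * X s w)%:E =
   ((p == q)%:R * (r == s)%:R + (p == r)%:R * (q == s)%:R
    + (p == s)%:R * (q == r)%:R)%:E)%E.
Proof.
rewrite (funext (fun w => congr1 EFin (prodE p q r s w))).
rewrite (integral_prod_independent indepX (fun i => integrable_at _ i)).
(* [X p] serves as reference variable; the moment formulas do not depend on the index. *)
pose M k : R := \int[P]_w (X p w ^+ k).
have ME k i : \int[P]_w (X i w ^+ k) = M k.
  have [oddk|evenk] := boolP (odd k).
    by rewrite /M !Rintegral_odd_expr_standard_normal.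
  by rewrite /M -(even_halfK evenk) !Rintegral_even_expr_standard_normal.
under eq_bigr do rewrite ME.
rewrite (@prod_moments_pairings _ _ M)// /M.
- by rewrite (Rintegral_even_expr_standard_normal (normalX p) 0) big_ord0.
- by rewrite (Rintegral_even_expr_standard_normal (normalX p) 1) big_ord1.
- rewrite (Rintegral_even_expr_standard_normal (normalX p) 2).
  by rewrite !big_ord_recr/= big_ord0 !mul1r.
- by move=> k; exact: Rintegral_odd_expr_standard_normal.
Qed.

End iid_standard_normal_product.

(** * The expected outer square of the Gram matrix *)

Theorem proposition28 (R : realType) (d : measure_display)
    (T : measurableType d) (P : probability T R) (m n : nat)
    (A : 'M[{RV P >-> R}]_(m, n)) (hA : iid_standard_normal A)
    (i1 i2 i3 i4 : 'I_n) :
  tensor_expectation P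
    (fun w : T =>
       let G := (sample_mx A w)^T *m sample_mx A w in outer_mx G G)
    i1 i2 i3 i4 =
  (m%:R ^+ 2 * kronecker R i1 i2 * kronecker R i3 i4
   + m%:R * kronecker R i1 i3 * kronecker R i2 i4
   + m%:R * kronecker R i1 i4 * kronecker R i2 i3)%:E.
Proof.
have [indepA normalA] := hA.
pose X (ij : 'I_m * 'I_n) := A ij.1 ij.2.
have normalX ij : standard_normal (X ij) by exact: normalA.
(* [kl] pairs the summation rows of the two Gram entries. *)
pose f (kl : 'I_m * 'I_m) w :=
  X (kl.1, i1) w * X (kl.1, i2) w * X (kl.2, i3) w * X (kl.2, i4) w.
have fE w : outer_mx ((sample_mx A w)^T *m sample_mx A w)
    ((sample_mx A w)^T *m sample_mx A w) i1 i2 i3 i4 = \sum_kl f kl w.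
  rewrite /outer_mx !mxE big_distrlr/= pair_big/=.
  by apply: eq_bigr => -[k l] _; rewrite !mxE /f /X/= mulrA.
rewrite /tensor_expectation unlock.
under eq_integral do rewrite /= fE -sumEFin.
rewrite integral_sum//; last first.
  by move=> kl; exact: integrable_product4_standard_normal.
(* Pairing factors of the same Gram entry compares columns only; pairing across entries also
   requires k = l. *)
under eq_bigr do rewrite (isserlis4 indepA normalX) !xpair_eqE !eqxx/=.
rewrite sumEFin; congr EFin.
rewrite -(pair_big xpredT xpredT (fun k l => (i1 == i2)%:R * (i3 == i4)%:R +
  ((k == l) && (i1 == i3))%:R * ((k == l) && (i2 == i4))%:R +
  ((k == l) && (i1 == i4))%:R * ((k == l) && (i2 == i3))%:R)) /=.
(* Summing over l, the first term is constant and gains a factor m, while the other two survive only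
   at l = k. *)
transitivity (\sum_(k < m) (m%:R * kronecker R i1 i2 * kronecker R i3 i4
   + kronecker R i1 i3 * kronecker R i2 i4
   + kronecker R i1 i4 * kronecker R i2 i3)).
  apply: eq_bigr => k _; rewrite !big_split/= sumr_const card_ord.
  rewrite -[_ *+ m]mulr_natl mulrA.
  by congr (_ + _ + _); rewrite (bigD1 k)//= eqxx big1 ?addr0// => l;
    rewrite eq_sym => /negbTE ->; rewrite mul0r.
rewrite sumr_const card_ord -mulr_natl; ring.
Qed.
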